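(* Let $0<\epsilon<1$. Let $\mathbf{A}$ be an $n^{\epsilon}$-approximation insertion-deletion streaming algorithm for \textsf{Maximum Matching} on $n$-vertex bipartite graphs that errs with probability at most $1/10$ and uses space $s$. Then there exists a (public-coin randomised one-way) communication protocol for $\textsf{BInd}^{n,\,n-\frac{1}{40}n^{1-\epsilon}}_{0.05}$ that communicates $\mathrm{O}(n^{\epsilon}\cdot s)$ bits.
   Context: An insertion-deletion (turnstile) graph stream on a fixed vertex set is a sequence of edge insertions and edge deletions, where each deletion removes a currently present edge; the input graph is the graph formed by the edges present at the end. A $C$-approximation insertion-deletion streaming algorithm for \textsf{Maximum Matching} that errs with probability at most $p$ processes such a stream using $s$ bits of memory and, with probability at least $1-p$, outputs a matching of the final graph of size at least $\mu/C$, where $\mu$ is the maximum matching size of the final graph. The problem $\textsf{BInd}^{n,k}_\delta$: Alice holds $A\in\{0,1\}^{n\times n}$; Bob holds $x,y\in[n-k]$ (where $[m]=\{1,\dots,m\}$) and the entries $(A_{i,j})_{(i,j)\in S(x,y)}$ with $S(x,y)=\{(i,j)\in[n]^2 : x\le i<x+k,\ y\le j<y+k\}\setminus\{(x,y)\}$; Alice sends one message to Bob, who must output $A_{x,y}$ with probability at least $1-\delta$. *)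

(* Defs.v *)
From mathcomp Require Import all_boot all_order all_algebra.
From mathcomp Require Import reals exp.

Set Implicit Arguments.
Unset Strict Implicit.
Unset Printing Implicit Defensive.

Import Order.TTheory GRing.Theory Num.Theory.
Local Open Scope ring_scope.

(** * Finite probability distributions *)

Record fdist (R : realType) (T : finType) := FDist {
  pmf :> {ffun T -> R};
  pmf_ge0 : forall t, 0 <= pmf t;
  pmf_sum1 : \sum_t pmf t = 1 }.

Definition Pr (R : realType) (T : finType) (d : fdist R T) (E : pred T) : R :=
  \sum_(t | E t) d t.

Section Bind.
Variables (R : realType) (T U : finType) (d : fdist R T) (k : T -> fdist R U).

Definition bind_pmf : {ffun U -> R} := [ffun u => \sum_t d t * k t u].

Lemma bind_pmf_ge0 u : 0 <= bind_pmf u.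
Proof. by rewrite ffunE sumr_ge0 // => t _; rewrite mulr_ge0 ?pmf_ge0. Qed.

Lemma bind_pmf_sum1 : \sum_u bind_pmf u = 1.
Proof.
under eq_bigr do rewrite ffunE.
rewrite exchange_big /= -(pmf_sum1 d); apply: eq_bigr => t _.
by rewrite -mulr_sumr pmf_sum1 mulr1.
Qed.

Definition fbind : fdist R U := FDist bind_pmf_ge0 bind_pmf_sum1.

End Bind.

(** * Graphs and matchings

A simple graph on the vertex set [V] is its set of edges, each edge being a
two-element subset of [V]. *)

Definition bipartite (V : finType) (G : {set {set V}}) : bool :=
  [exists L : {set V}, [forall e in G, #|e :&: L| == 1%N]].

Definition is_matching (V : finType) (G M : {set {set V}}) : bool :=
  (M \subset G) && trivIset M.

Definition matching_number (V : finType) (G : {set {set V}}) : nat :=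
  \max_(M : {set {set V}} | is_matching G M) #|M|.

(** * Insertion-deletion streams *)

Inductive update (V : finType) :=
| Insert of {set V}
| Delete of {set V}.

(* Graphs are simple: an edge can only be inserted while it is absent. *)
Definition legal (V : finType) (G : {set {set V}}) (u : update V) : bool :=
  match u with
  | Insert e => (#|e| == 2%N) && (e \notin G)
  | Delete e => e \in G
  end.

Definition apply_update (V : finType) (G : {set {set V}}) (u : update V) :
    {set {set V}} :=
  match u with
  | Insert e => e |: G
  | Delete e => G :\ e
  end.

Fixpoint valid_from (V : finType) (G : {set {set V}})
    (st : seq (update V)) : bool :=
  if st is u :: st' then legal G u && valid_from (apply_update G u) st'
  else true.

Definition valid_stream (V : finType) (st : seq (update V)) : bool :=
  valid_from set0 st.

Definition final_graph (V : finType) (st : seq (update V)) : {set {set V}} :=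
  foldl (@apply_update V) set0 st.

(** * Streaming algorithms

The memory always consists of exactly [s] bits.  There are two sources of
randomness: a random seed, drawn once, readable at any time and not counted
as memory; and fresh coins, tossed at every step, whose outcomes are
forgotten unless they are kept in memory.  This covers both usual models:
an algorithm tossing fresh coins is a Markov kernel on the finite set of
memories (with a trivial seed), and an algorithm that is deterministic given
an arbitrary seed is a distribution over the finitely many deterministic
algorithms on [V] with [s] bits of memory. *)

Record stream_alg (R : realType) (V : finType) (s : nat) := StreamAlg {
  seed : finType;
  seed_dist : fdist R seed;
  init : seed -> fdist R (s.-tuple bool);
  step : seed -> update V -> s.-tuple bool -> fdist R (s.-tuple bool);
  output : seed -> s.-tuple bool -> fdist R {set {set V}} }.

Definition run (R : realType) (V : finType) (s : nat) (A : stream_alg R V s)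
    (r : seed A) (st : seq (update V)) : fdist R (s.-tuple bool) :=
  foldl (fun d u => fbind d (step r u)) (init r) st.

Definition alg_output (R : realType) (V : finType) (s : nat)
    (A : stream_alg R V s) (st : seq (update V)) : fdist R {set {set V}} :=
  fbind (seed_dist A) (fun r => fbind (run r st) (output r)).

(* [A] is a [C]-approximation algorithm for Maximum Matching on bipartite
   graphs with vertex set [V], erring with probability at most [p]. *)
Definition bipartite_matching_alg (R : realType) (V : finType) (s : nat)
    (A : stream_alg R V s) (C p : R) : Prop :=
  forall st : seq (update V),
    valid_stream st -> bipartite (final_graph st) ->
    1 - p <= Pr (alg_output A st) (fun M =>
      is_matching (final_graph st) M &&
      ((matching_number (final_graph st))%:R / C <= #|M|%:R)).

(** * The problem BInd

Indices are 0-based, so that [x : 'I_n] stands for the index [x.+1] of [1..n].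
The parameter [k] may be any real number; the conditions below are the
defining inequalities taken literally, and agree with the usual ones when
[k] is an integer. *)

Definition BInd_range (R : realType) (n : nat) (k : R) (x : 'I_n) : bool :=
  x.+1%:R <= n%:R - k.

Definition BInd_window (R : realType) (n : nat) (k : R) (x i : 'I_n) : bool :=
  (x <= i)%N && (i%:R < x%:R + k).

Definition BInd_known (R : realType) (n : nat) (k : R) (x y i j : 'I_n) : bool :=
  [&& BInd_window k x i, BInd_window k y j & (i, j) != (x, y)].

Definition BInd_view (R : realType) (n : nat) (k : R) (A : 'M[bool]_n)
    (x y : 'I_n) : 'M[option bool]_n :=
  \matrix_(i, j) if BInd_known k x y i j then Some (A i j) else None.

(* Public-coin one-way protocols in which Alice sends [b] bits. *)
Record protocol (R : realType) (n b : nat) := Protocol {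
  coin : finType;
  coin_dist : fdist R coin;
  alice : coin -> 'M[bool]_n -> b.-tuple bool;
  bob : coin -> b.-tuple bool -> 'I_n -> 'I_n -> 'M[option bool]_n -> bool }.

Definition solves_BInd (R : realType) (n b : nat) (k delta : R)
    (P : protocol R n b) : Prop :=
  forall (A : 'M[bool]_n) (x y : 'I_n),
    BInd_range k x -> BInd_range k y ->
    1 - delta <= Pr (coin_dist P) (fun r =>
      bob r (alice r A) x y (BInd_view k A x y) == A x y).

(* Main.v *)
(** Label the rows and columns of the top left quarter of the matrix by the
    vertices of the graph through a public random permutation, and flip its
    entries by public random bits, so that Alice inserts a uniformly random
    bipartite graph. Bob then deletes every edge he knows, except those on the
    diagonal through (x, y). What he cannot delete lies in fewer than
    n^(1-eps)/40 rows and columns, whereas about half of the diagonal, i.e. at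
    least 9n/40 edges in expectation, is a matching of the final graph. An
    n^eps-approximate matching must therefore contain of order n^(1-eps)
    diagonal edges, and by symmetry the hidden edge, if present, is one of
    them with probability of order n^(-eps), which reveals the entry (x, y).

    The algorithm may also err. Bob ignores an output containing a diagonal
    non-edge that he can recognise, so he is only misled when the hidden pair
    is the unique diagonal non-edge of the output; by symmetry this happens
    with probability at most 1/(10 d), where d is the length of the diagonal.
    This is smaller than the probability of success by a factor of order
    n^(1-eps), so O(n^eps) parallel repetitions suffice. *)

Require Import Defs.
From mathcomp Require Import all_boot all_order all_algebra all_fingroup.
From mathcomp Require Import reals exp.
From mathcomp Require Import ring lra zify.

Set Implicit Arguments.
Unset Strict Implicit.
Unset Printing Implicit Defensive.

Import Order.TTheory GRing.Theory Num.Theory.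
Local Open Scope ring_scope.

(** * Expectations *)

Section Expectation.
Variable R : realType.

Definition Ex (T : finType) (d : fdist R T) (f : T -> R) : R :=
  \sum_t d t * f t.

Lemma PrE (T : finType) (d : fdist R T) (E : pred T) :
  Pr d E = Ex d (fun t => (E t)%:R).
Proof.
rewrite /Pr /Ex big_mkcond; apply: eq_bigr => t _.
by case: (E t); rewrite ?mulr1 ?mulr0.
Qed.

Lemma eq_Ex (T : finType) (d : fdist R T) (f g : T -> R) :
  f =1 g -> Ex d f = Ex d g.
Proof. by move=> fg; apply: eq_bigr => t _; rewrite fg. Qed.

Lemma le_Ex (T : finType) (d : fdist R T) (f g : T -> R) :
  (forall t, f t <= g t) -> Ex d f <= Ex d g.
Proof. by move=> fg; apply: ler_sum => t _; rewrite ler_wpM2l ?pmf_ge0. Qed.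

Lemma Ex_cst (T : finType) (d : fdist R T) (c : R) : Ex d (fun=> c) = c.
Proof. by rewrite /Ex -mulr_suml pmf_sum1 mul1r. Qed.

Lemma ExD (T : finType) (d : fdist R T) (f g : T -> R) :
  Ex d (fun t => f t + g t) = Ex d f + Ex d g.
Proof. by rewrite /Ex -big_split; apply: eq_bigr => t _; rewrite mulrDr. Qed.

Lemma ExZ (T : finType) (d : fdist R T) (c : R) (f : T -> R) :
  Ex d (fun t => c * f t) = c * Ex d f.
Proof. by rewrite /Ex mulr_sumr; apply: eq_bigr => t _; rewrite mulrCA. Qed.

Lemma Ex_sum (T I : finType) (d : fdist R T) (P : pred I) (f : I -> T -> R) :
  Ex d (fun t => \sum_(i | P i) f i t) = \sum_(i | P i) Ex d (f i).
Proof.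
by rewrite /Ex exchange_big; apply: eq_bigr => t _; rewrite mulr_sumr.
Qed.

Lemma Ex_fbind (T U : finType) (d : fdist R T) (k : T -> fdist R U)
    (f : U -> R) : Ex (fbind d k) f = Ex d (fun t => Ex (k t) f).
Proof.
rewrite /Ex /=; under eq_bigr do rewrite ffunE mulr_suml.
rewrite exchange_big; apply: eq_bigr => t _; rewrite mulr_sumr.
by apply: eq_bigr => u _; rewrite mulrA.
Qed.

Lemma PrC (T : finType) (d : fdist R T) (E : pred T) :
  Pr d (predC E) = 1 - Pr d E.
Proof.
apply/eqP; rewrite eq_sym subr_eq eq_sym !PrE -ExD; apply/eqP.
rewrite -[RHS](Ex_cst d); apply: eq_Ex => t /=.
by case: (E t); rewrite ?add0r ?addr0.
Qed.

Section Dirac.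
Variables (T : finType) (t0 : T).

Definition dirac_pmf : {ffun T -> R} := [ffun t => (t == t0)%:R].

Lemma dirac_pmf_ge0 t : 0 <= dirac_pmf t.
Proof. by rewrite ffunE ler0n. Qed.

Lemma dirac_pmf_sum (f : T -> R) : \sum_t dirac_pmf t * f t = f t0.
Proof.
rewrite (bigD1 t0) //= ffunE eqxx mul1r big1 ?addr0 // => t /negPf.
by rewrite ffunE => ->; rewrite mul0r.
Qed.

Lemma dirac_pmf_sum1 : \sum_t dirac_pmf t = 1.
Proof.
by rewrite -[RHS](dirac_pmf_sum (fun=> 1)); apply: eq_bigr => t; rewrite mulr1.
Qed.

Definition dirac := FDist dirac_pmf_ge0 dirac_pmf_sum1.

Lemma Ex_dirac (f : T -> R) : Ex dirac f = f t0.
Proof. exact: dirac_pmf_sum. Qed.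

End Dirac.

Section Uniform.
Variables (T : finType) (t0 : T).

Definition unif_pmf : {ffun T -> R} := [ffun=> #|T|%:R^-1].

Lemma unif_pmf_ge0 t : 0 <= unif_pmf t.
Proof. by rewrite ffunE invr_ge0 ler0n. Qed.

Lemma unif_pmf_sum1 : \sum_t unif_pmf t = 1.
Proof.
under eq_bigr do rewrite ffunE.
rewrite sumr_const -[LHS]mulr_natl divff //.
by rewrite pnatr_eq0 -lt0n; apply/card_gt0P; exists t0.
Qed.

Definition unif := FDist unif_pmf_ge0 unif_pmf_sum1.

(** All symmetries below are of this kind: swapping positions, complementing the random edge set,
    masking by Alice's matrix. *)
Lemma Ex_unif_reindex (phi : T -> T) (f : T -> R) :
  injective phi -> Ex unif f = Ex unif (f \o phi).
Proof.
move=> inj; rewrite /Ex (reindex_inj inj); apply: eq_bigr => t _ /=.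
by rewrite !ffunE.
Qed.

End Uniform.

Section Product.
Variables (T U : finType) (d : fdist R T) (d' : fdist R U).

Definition prod_pmf : {ffun T * U -> R} := [ffun p => d p.1 * d' p.2].

Lemma prod_pmf_ge0 p : 0 <= prod_pmf p.
Proof. by rewrite ffunE mulr_ge0 ?pmf_ge0. Qed.

Lemma prod_pmf_sum (f : T * U -> R) :
  \sum_p prod_pmf p * f p = Ex d (fun t => Ex d' (fun u => f (t, u))).
Proof.
rewrite /Ex; under [RHS]eq_bigr do rewrite mulr_sumr.
rewrite pair_big; apply: eq_bigr => -[t u] _ /=.
by rewrite ffunE mulrA.
Qed.

Lemma prod_pmf_sum1 : \sum_p prod_pmf p = 1.
Proof.
under eq_bigr do rewrite -[prod_pmf _]mulr1.
by rewrite prod_pmf_sum -[RHS](Ex_cst d); apply: eq_Ex => t; rewrite Ex_cst.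
Qed.

Definition prod_dist := FDist prod_pmf_ge0 prod_pmf_sum1.

Lemma Ex_prod (f : T * U -> R) :
  Ex prod_dist f = Ex d (fun t => Ex d' (fun u => f (t, u))).
Proof. exact: prod_pmf_sum. Qed.

End Product.

(* A kernel is simulated by drawing, once and for all, an independent outcome
   for each of its inputs. *)
Section Kernel.
Variables (T U : finType) (k : T -> fdist R U).

Definition kernel_pmf : {ffun {ffun T -> U} -> R} :=
  [ffun f : {ffun T -> U} => \prod_t k t (f t)].

Lemma kernel_pmf_ge0 f : 0 <= kernel_pmf f.
Proof. by rewrite ffunE prodr_ge0 // => t _; rewrite pmf_ge0. Qed.

Lemma kernel_pmf_sum1 : \sum_f kernel_pmf f = 1.
Proof.
under eq_bigr do rewrite ffunE.
rewrite -(bigA_distr_bigA (fun t u => k t u)) big1 // => t _.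
exact: pmf_sum1.
Qed.

Definition kernel_dist := FDist kernel_pmf_ge0 kernel_pmf_sum1.

Lemma Ex_kernel (t0 : T) (g : U -> R) :
  Ex kernel_dist (fun f => g (f t0)) = Ex (k t0) g.
Proof.
transitivity (\sum_(f : {ffun T -> U})
    \prod_t (k t (f t) * (if t == t0 then g (f t) else 1))).
  apply: eq_bigr => f _ /=; rewrite ffunE big_split /=; congr (_ * _).
  by rewrite -big_mkcond big_pred1_eq.
rewrite -(bigA_distr_bigA (fun t u => k t u * (if t == t0 then g u else 1))).
rewrite (bigD1 t0) //= eqxx [X in _ * X]big1 ?mulr1 // => t /negPf ->.
by under eq_bigr do rewrite mulr1; rewrite pmf_sum1.
Qed.

End Kernel.

End Expectation.

(** * Amplification *)

(* If [p0] and [q] bound below and above the probabilities of a right and a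
   wrong answer in one round, answering with the first round that does not
   abstain errs with probability at most [err' = (1 - p0) err + q] after one
   more round; [(1 - p0) ^+ t + q / p0] solves this recursion. *)
Lemma amplify (R : realType) (n s : nat) (c : finType) (d : fdist R c)
    (al : c -> 'M[bool]_n -> s.-tuple bool)
    (bo : c -> s.-tuple bool -> 'I_n -> 'I_n -> 'M[option bool]_n ->
          option bool) (k p0 q : R) (t : nat) :
  0 < p0 -> 0 <= q ->
  (forall (A : 'M[bool]_n) (x y : 'I_n), BInd_range k x -> BInd_range k y ->
     p0 <= Pr d (fun r =>
       bo r (al r A) x y (BInd_view k A x y) == Some (A x y))) ->
  (forall (A : 'M[bool]_n) (x y : 'I_n), BInd_range k x -> BInd_range k y ->
     Pr d (fun r =>
       bo r (al r A) x y (BInd_view k A x y) == Some (~~ A x y)) <= q) ->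
  exists P : protocol R n (t * s),
    solves_BInd k ((1 - p0) ^+ t + q / p0) P.
Proof.
move=> p0_gt0 q_ge0 right wrong; elim: t => [|t [P solP]].
  (* With no rounds the allowed error [1 + q / p0] is at least 1, so any answer will do. *)
  exists (@Protocol R n 0 unit (dirac R tt) (fun _ _ => [tuple])
    (fun _ _ _ _ _ => false)) => A x y _ _.
  rewrite expr0 opprD addrA subrr add0r.
  apply: le_trans (_ : 0 <= _); first by rewrite oppr_le0 divr_ge0 // ltW.
  by rewrite /Pr sumr_ge0 // => i _; exact: pmf_ge0.
pose fst_part (m : (s + t * s).-tuple bool) : s.-tuple bool :=
  [tuple tnth m (lshift _ i) | i < s].
pose snd_part (m : (s + t * s).-tuple bool) : (t * s).-tuple bool :=
  [tuple tnth m (rshift _ i) | i < t * s].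
exists (@Protocol R n (s + t * s) (c * coin P)%type (prod_dist d (coin_dist P))
  (fun r A => cat_tuple (al r.1 A) (alice r.2 A))
  (fun r m x y B => if bo r.1 (fst_part m) x y B is Some a then a
                    else bob r.2 (snd_part m) x y B)) => A x y hx hy /=.
have fst_partE m1 m2 : fst_part (cat_tuple m1 m2) = m1.
  by apply: eq_from_tnth => i; rewrite tnth_mktuple tnth_lshift.
have snd_partE m1 m2 : snd_part (cat_tuple m1 m2) = m2.
  by apply: eq_from_tnth => i; rewrite tnth_mktuple tnth_rshift.
have := solP A x y hx hy; have := right A x y hx hy; have := wrong A x y hx hy.
set V := BInd_view k A x y; rewrite !PrE Ex_prod /=.
pose e r := bo r (al r A) x y V.
pose S := Ex (coin_dist P) (fun r => (bob r (alice r A) x y V == A x y)%:R).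
rewrite -/S -/(Ex d (fun r => (e r == Some (A x y))%:R)).
set pr := Ex d (fun r => (e r == Some (A x y))%:R).
rewrite -/(Ex d (fun r => (e r == Some (~~ A x y))%:R)).
set pw := Ex d _ => hw hr hS.
(* The recursive protocol decides exactly when the round abstains, an event whose indicator is 1
   minus those of a right and of a wrong answer. *)
have -> : Ex d (fun r => Ex (coin_dist P) (fun u =>
    ((if bo r (fst_part (cat_tuple (al r A) (alice u A))) x y V is Some a
      then a else bob u (snd_part (cat_tuple (al r A) (alice u A))) x y V)
     == A x y)%:R)) =
    Ex d (fun r => (e r == Some (A x y))%:R +
       S * (1 + (-1) * (e r == Some (A x y))%:R
              + (-1) * (e r == Some (~~ A x y))%:R)).
  apply: eq_Ex => r.
  transitivity (if e r is Some a then (a == A x y)%:R else S).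
    rewrite /e; case E: (bo r _ x y V) => [a|].
      by under eq_Ex do rewrite fst_partE E; rewrite Ex_cst.
    by apply: eq_Ex => u; rewrite fst_partE E snd_partE.
  case: (e r) => [a|] /=; last by rewrite !mulr0 !addr0 add0r mulr1.
  by case: a; case: (A x y) => /=; ring.
rewrite ExD ExZ !ExD !ExZ Ex_cst -/pr -/pw exprS.
have S_le1 : S <= 1.
  by rewrite -[leRHS](Ex_cst (coin_dist P)); apply: le_Ex => r; case: (_ == _).
have S_ge0 : 0 <= S.
  by rewrite -(Ex_cst (coin_dist P) 0); apply: le_Ex => r; case: (_ == _).
have hp : pr + pw <= 1.
  rewrite -[leRHS](Ex_cst d) -ExD; apply: le_Ex => r.
  by rewrite -!/(e r); case: (e r) => [[]|] /=; case: (A x y) => /=; lra.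
have pw_ge0 : 0 <= pw.
  by rewrite -(Ex_cst d 0); apply: le_Ex => r; case: (_ == _).
set E := (1 - p0) ^+ t in hS *.
have qE : q = p0 * (q / p0) by rewrite mulrCA divff ?mulr1 ?gt_eqF.
set z := q / p0 in qE hS *.
nra.
Qed.

(** * Streams *)

Section Streams.
Variable V : finType.
Implicit Types E F G : {set {set V}}.

Definition insertions E : seq (update V) := [seq Insert e | e <- enum E].

Definition deletions F : seq (update V) := [seq Delete e | e <- enum F].

Lemma insertions_valid_final G (l : seq {set V}) :
  uniq l -> all (fun e : {set V} => (#|e| == 2%N) && (e \notin G)) l ->
  valid_from G [seq Insert e | e <- l] /\
  foldl (@apply_update V) G [seq Insert e | e <- l] = G :|: [set e in l].
Proof.
elim: l G => [|e l IH] G /=.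
  by split=> //; apply/setP => f; rewrite !inE orbF.
case/andP=> el ul /andP[/andP[e2 eG] al].
have [|-> ->] := IH (e |: G) ul.
  apply/allP => f fl; case/andP: (allP al _ fl) => -> fG /=.
  by rewrite !inE negb_or fG andbT; apply: contraNneq el => <-.
by rewrite e2 eG; split=> //; apply/setP => f; rewrite !inE orbCA orbA.
Qed.

Lemma deletions_valid_final G (l : seq {set V}) :
  uniq l -> all (fun e : {set V} => e \in G) l ->
  valid_from G [seq Delete e | e <- l] /\
  foldl (@apply_update V) G [seq Delete e | e <- l] = G :\: [set e in l].
Proof.
elim: l G => [|e l IH] G /=; first by split=> //; apply/setP => f; rewrite !inE.
case/andP=> el ul /andP[eG al].
have [|-> ->] := IH (G :\ e) ul.
  apply/allP => f fl; have fG := allP al _ fl; rewrite !inE fG andbT.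
  by apply: contraNneq el => <-.
rewrite eG; split=> //; apply/setP => f.
by rewrite !inE negb_or -andbA andbCA andbA.
Qed.

Lemma valid_from_cat G (l l' : seq (update V)) :
  valid_from G (l ++ l') =
  valid_from G l && valid_from (foldl (@apply_update V) G l) l'.
Proof. by elim: l G => //= u l IH G; rewrite IH andbA. Qed.

(** Enumerations list each edge once, so every insertion finds its edge absent and every deletion
    finds it present. *)
Lemma insert_delete E F :
  {in E, forall e : {set V}, #|e| = 2%N} -> F \subset E ->
  valid_stream (insertions E ++ deletions F) /\
  final_graph (insertions E ++ deletions F) = E :\: F.
Proof.
move=> E2 FE; rewrite /valid_stream /final_graph valid_from_cat foldl_cat.
have [||-> ->] := @insertions_valid_final set0 (enum E); first exact: enum_uniq.
  by apply/allP => e; rewrite mem_enum inE => /E2 ->.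
have -> : set0 :|: [set e in enum E] = E.
  by apply/setP => e; rewrite !inE mem_enum.
have [||-> ->] := @deletions_valid_final E (enum F); first exact: enum_uniq.
  by apply/allP => e; rewrite mem_enum => /(subsetP FE).
by split=> //; apply/setP => e; rewrite !inE mem_enum.
Qed.

End Streams.

(** * Splitting a streaming algorithm between Alice and Bob *)

Section Simulation.
Variables (R : realType) (V : finType) (s : nat) (A : stream_alg R V s).

Definition resume (r : seed A) (m : s.-tuple bool) (st : seq (update V)) :
    fdist R (s.-tuple bool) :=
  foldl (fun d u => fbind d (step r u)) (dirac R m) st.

(** Markov property: a step depends only on the seed, which is public, and on the memory, which is
    thus all that Alice must send. *)
Lemma Ex_foldl_resume (r : seed A) (d : fdist R (s.-tuple bool))
    (st : seq (update V)) (f : s.-tuple bool -> R) :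
  Ex (foldl (fun d u => fbind d (step r u)) d st) f =
  Ex d (fun m => Ex (resume r m st) f).
Proof.
elim: st d => [|u st IH] d /=; first by apply: eq_Ex => m; rewrite Ex_dirac.
rewrite IH Ex_fbind; apply: eq_Ex => m.
by rewrite [in RHS]/resume /= IH Ex_fbind Ex_dirac.
Qed.

Variables (Om : finType) (om0 : Om).

(** Messages and answers of a protocol are deterministic given its coins, so the coins include a
    table of presampled outcomes for each player. *)
Definition sim_coin : finType :=
  (Om * seed A * {ffun seed A * {set {set V}} -> s.-tuple bool} *
   {ffun seed A * {set {set V}} * s.-tuple bool -> {set {set V}}})%type.

Definition sim_dist : fdist R sim_coin :=
  prod_dist (prod_dist (prod_dist (unif R om0) (seed_dist A))
    (kernel_dist (fun p : seed A * {set {set V}} =>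
       run p.1 (insertions p.2))))
    (kernel_dist (fun p : seed A * {set {set V}} * s.-tuple bool =>
       fbind (resume p.1.1 p.2 (deletions p.1.2)) (output p.1.1))).

Definition sim_om (c : sim_coin) : Om := c.1.1.1.

Definition sim_mem (c : sim_coin) (E : {set {set V}}) : s.-tuple bool :=
  c.1.2 (c.1.1.2, E).

Definition sim_out (c : sim_coin) (F : {set {set V}}) (m : s.-tuple bool) :
    {set {set V}} :=
  c.2 (c.1.1.2, F, m).

(** Once [om] and the seed are fixed, Alice reads one entry of her table and Bob, given her message,
    one entry of his; such an entry has the law of the kernel. *)
Lemma Ex_sim (E F : Om -> {set {set V}}) (f : Om -> {set {set V}} -> R) :
  Ex sim_dist (fun c =>
    f (sim_om c) (sim_out c (F (sim_om c)) (sim_mem c (E (sim_om c))))) =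
  Ex (unif R om0) (fun om =>
    Ex (alg_output A (insertions (E om) ++ deletions (F om))) (f om)).
Proof.
rewrite !Ex_prod; apply: eq_Ex => om; rewrite Ex_fbind; apply: eq_Ex => r.
rewrite Ex_fbind /run foldl_cat Ex_foldl_resume.
rewrite -(Ex_kernel (fun p : seed A * {set {set V}} =>
  run p.1 (insertions p.2)) (r, E om)); apply: eq_Ex => g.
rewrite -Ex_fbind /sim_out /sim_mem /sim_om /=.
exact: (Ex_kernel (fun p : seed A * {set {set V}} * s.-tuple bool =>
       fbind (resume p.1.1 p.2 (deletions p.1.2)) (output p.1.1))
  (r, F om, g (r, E om)) (f om)).
Qed.

End Simulation.

(** * The hidden edge *)

(** Disjoint edges pick distinct vertices of [Q]. *)
Lemma card_matching_hitting (V : finType) (M : {set {set V}}) (Q : {set V}) :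
  trivIset M -> {in M, forall e : {set V}, e :&: Q != set0} -> (#|M| <= #|Q|)%N.
Proof.
move=> trivM hitM.
pose f (e : {set V}) := [pick v in e :&: Q].
have fP e : e \in M -> exists2 v, f e = Some v & (v \in e) && (v \in Q).
  move=> /hitM /set0Pn[v ve]; rewrite /f; case: pickP => [w|/(_ v)].
    by rewrite inE => we; exists w.
  by rewrite ve.
have f_inj : {in M &, injective f}.
  move=> e e' eM eM' ff; have [v fv /andP[ve _]] := fP e eM.
  have [w fw /andP[we' _]] := fP e' eM'.
  move: fw; rewrite -ff fv => -[vw]; rewrite -vw in we'.
  apply: contraTeq trivM => ne; apply/trivIsetP => /(_ e e' eM eM' ne).
  by move/pred0P/(_ v); rewrite /= ve we'.
rewrite -(card_in_imset f_inj) -(card_imset Q Some_inj).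
apply/subset_leq_card/subsetP => o /imsetP[e eM ->].
by have [v -> /andP[_ vQ]] := fP e eM; apply: imset_f.
Qed.

(* Row [i] and column [j] of the top left quarter of the matrix are the
   vertices [i] and [rev_ord j], relabelled by [pi]. *)
Definition pedge (n : nat) (pi : {perm 'I_n}) (p : 'I_n * 'I_n) : {set 'I_n} :=
  [set pi p.1; pi (rev_ord p.2)].

Definition quarter (n : nat) : {set 'I_n * 'I_n} :=
  [set p : 'I_n * 'I_n | (p.1 < n./2)%N & (p.2 < n./2)%N].

(** When the window has side at least [n./2], these and [(x, y)] itself are the entries of the
    quarter that Bob lacks. *)
Definition unseen (n : nat) (x y : 'I_n) : {set 'I_n * 'I_n} :=
  [set p in quarter n | (p.1 < x)%N || (p.2 < y)%N].

(** Distinct positions here share neither row nor column, which makes their edges a matching and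
    lets any of them trade places with [(x, y)]. *)
Definition diagonal (n : nat) (x y : 'I_n) : {set 'I_n * 'I_n} :=
  [set p in quarter n | [&& (x <= p.1)%N, (y <= p.2)%N
                         & (p.1 + y == p.2 + x)%N]].

Section Geometry.
Variable n : nat.
Implicit Types (pi : {perm 'I_n}) (p q : 'I_n * 'I_n) (Y M : {set {set 'I_n}}).

(** Rows use the first [n./2] labels, and reversal sends columns to the last [n./2]. *)
Lemma row_neq_col (i j : 'I_n) :
  (i < n./2)%N -> (j < n./2)%N -> (i == rev_ord j) = false.
Proof. by move=> hi hj; apply/negP => /eqP/(congr1 val) /=; lia. Qed.

Lemma mem_pedge pi p (v : 'I_n) :
  (pi v \in pedge pi p) = (v == p.1) || (v == rev_ord p.2).
Proof. by rewrite !inE !(inj_eq perm_inj). Qed.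

Lemma mem_pedge_row pi p (i : 'I_n) : p \in quarter n -> (i < n./2)%N ->
  (pi i \in pedge pi p) = (i == p.1).
Proof.
by rewrite inE => /andP[_ hp] hi; rewrite mem_pedge row_neq_col // orbF.
Qed.

Lemma mem_pedge_col pi p (j : 'I_n) : p \in quarter n -> (j < n./2)%N ->
  (pi (rev_ord j) \in pedge pi p) = (j == p.2).
Proof.
rewrite inE => /andP[hp _] hj; rewrite mem_pedge (inj_eq rev_ord_inj).
by rewrite eq_sym row_neq_col.
Qed.

Lemma pedge_inj pi : {in quarter n &, injective (pedge pi)}.
Proof.
move=> [i j] [i' j'] hp hq e; move: (hp); rewrite inE /= => /andP[hi hj].
have := mem_pedge_row pi hq hi; have := mem_pedge_col pi hq hj.
rewrite -e (mem_pedge_row pi hp hi) (mem_pedge_col pi hp hj) !eqxx.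
by move=> /esym/eqP -> /esym/eqP ->.
Qed.

Lemma card_pedge pi p : p \in quarter n -> #|pedge pi p| = 2%N.
Proof.
rewrite inE => /andP[hi hj]; rewrite cards2 (inj_eq perm_inj) row_neq_col //.
Qed.

Lemma bipartite_pedge pi (G : {set {set 'I_n}}) :
  G \subset pedge pi @: quarter n -> bipartite G.
Proof.
move=> sub; apply/existsP; exists (pi @: [set v : 'I_n | (v < n./2)%N]).
apply/forall_inP => _ /(subsetP sub)/imsetP[[i j] hp ->].
move: (hp); rewrite inE /= => /andP[hi hj].
rewrite (_ : _ :&: _ = [set pi i]) ?cards1 //; apply/setP => v.
rewrite -[v](permKV pi); set w := (pi^-1)%g v.
rewrite in_setI mem_pedge (mem_imset _ _ perm_inj) !inE (inj_eq perm_inj) /=.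
case: (w =P i) => [->|_] /=; first by rewrite hi.
by case: eqP => //= ->; apply/negbTE; rewrite /= -leqNgt; lia.
Qed.

Variables (x y : 'I_n).
Hypotheses (hx : (x < n./2)%N) (hy : (y < n./2)%N).

Lemma unseen_quarter : unseen x y \subset quarter n.
Proof. by apply/subsetP => p; rewrite inE => /andP[]. Qed.

Lemma diagonal_quarter : diagonal x y \subset quarter n.
Proof. by apply/subsetP => p; rewrite inE => /andP[]. Qed.

Lemma corner_diagonal : (x, y) \in diagonal x y.
Proof. by rewrite !inE /= hx hy !leqnn addnC eqxx. Qed.

Lemma diagonal_eq_row p q :
  p \in diagonal x y -> q \in diagonal x y -> p.1 = q.1 -> p = q.
Proof.
case: p q => [i j] [i' j']; rewrite !inE /= => /and4P[_ _ _ /eqP e].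
move=> /and4P[_ _ _ /eqP e'] ii; congr (_, _) => //.
by apply/val_inj => /=; rewrite -ii in e'; lia.
Qed.

Lemma diagonal_eq_col p q :
  p \in diagonal x y -> q \in diagonal x y -> p.2 = q.2 -> p = q.
Proof.
case: p q => [i j] [i' j']; rewrite !inE /= => /and4P[_ _ _ /eqP e].
move=> /and4P[_ _ _ /eqP e'] jj; congr (_, _) => //.
by apply/val_inj => /=; rewrite -jj in e'; lia.
Qed.

Lemma diagonal_matching pi Y :
  trivIset (Y :&: pedge pi @: diagonal x y).
Proof.
apply/trivIsetP => e e'; rewrite !inE.
move=> /andP[_ /imsetP[p hp ->]] /andP[_ /imsetP[q hq ->]] ne.
have hpK := subsetP diagonal_quarter p hp.
have hqK := subsetP diagonal_quarter q hq.
move: (hpK); rewrite inE => /andP[h1 h2].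
apply/pred0P => v; rewrite -[v](permKV pi); apply/negP => /andP[/= vp vq].
apply: (negP ne); apply/eqP; congr pedge.
move: vp; rewrite mem_pedge => /orP[] /eqP w.
  apply: diagonal_eq_row hp hq _; apply/eqP.
  by rewrite -(mem_pedge_row pi hqK h1) -w.
apply: diagonal_eq_col hp hq _; apply/eqP.
by rewrite -(mem_pedge_col pi hqK h2) -w.
Qed.

Lemma card_diagonal : (n./2 - maxn x y <= #|diagonal x y|)%N.
Proof.
have hf1 (t : 'I_(n./2 - maxn x y)) : (x + t < n)%N by have := ltn_ord t; lia.
have hf2 (t : 'I_(n./2 - maxn x y)) : (y + t < n)%N by have := ltn_ord t; lia.
pose f t := (Ordinal (hf1 t), Ordinal (hf2 t)).
have f_inj : injective f by move=> t u [e _]; apply/val_inj => /=; lia.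
rewrite -[leqLHS]card_ord -(card_imset _ f_inj).
apply/subset_leq_card/subsetP => _ /imsetP[t _ ->].
by have := ltn_ord t; rewrite !inE /=; lia.
Qed.

(* Swapping the row of [p] with [x] and its column with [y] turns the hidden
   edge into the edge of [p] and preserves everything else Bob knows. *)
Definition swap p : {perm 'I_n} :=
  (tperm x p.1 * tperm (rev_ord y) (rev_ord p.2))%g.

Definition swap_pos p q : 'I_n * 'I_n := (tperm x p.1 q.1, tperm y p.2 q.2).

Lemma swap_posK p : involutive (swap_pos p).
Proof. by case=> i j; rewrite /swap_pos /= !tpermK. Qed.

Lemma tperm_ltn (m : nat) (a b i : 'I_n) : (a < m)%N -> (b < m)%N ->
  (tperm a b i < m)%N = (i < m)%N.
Proof. by move=> ha hb; case: tpermP => [->|->|//]; rewrite ha hb. Qed.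

Lemma tperm_leq (m : nat) (a b i : 'I_n) : (m <= a)%N -> (m <= b)%N ->
  (tperm a b i < m)%N = (i < m)%N.
Proof.
by move=> ha hb; case: tpermP => [->|->|//]; rewrite !ltnNge ha hb.
Qed.

Section Swap.
Variable p : 'I_n * 'I_n.
Hypothesis hp : p \in diagonal x y.

Lemma swap_pos_quarter q : (swap_pos p q \in quarter n) = (q \in quarter n).
Proof.
move: hp; rewrite !inE /= => /andP[/andP[h1 h2] _].
by rewrite !tperm_ltn.
Qed.

(** Since [p] is weakly beyond [(x, y)] in both coordinates, no row index below [x] and no column
    index below [y] is moved. *)
Lemma swap_pos_unseen q : (swap_pos p q \in unseen x y) = (q \in unseen x y).
Proof.
rewrite [LHS]inE [RHS]inE swap_pos_quarter.
move: hp; rewrite !inE /= => /and4P[_ h1 h2 _].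
by rewrite !tperm_leq.
Qed.

(** The map exchanges [(x, y)] with [p] and fixes the other diagonal positions, whose rows and
    columns differ from theirs. *)
Lemma swap_pos_diagonal q :
  (swap_pos p q \in diagonal x y) = (q \in diagonal x y).
Proof.
have imp q' : q' \in diagonal x y -> swap_pos p q' \in diagonal x y.
  move=> hq; have cd := corner_diagonal.
  case: (q' =P (x, y)) => [->|nxy].
    by rewrite /swap_pos /= !tpermL -surjective_pairing.
  case: (q' =P p) => [->|np]; first by rewrite /swap_pos /= !tpermR.
  rewrite /swap_pos !tpermD -?surjective_pairing //; apply/eqP => e.
  - by apply: nxy; apply: diagonal_eq_col.
  - by apply: np; apply: diagonal_eq_col.
  - by apply: nxy; apply: diagonal_eq_row.
  - by apply: np; apply: diagonal_eq_row.
by apply/idP/idP => /imp //; rewrite swap_posK.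
Qed.

Lemma pedge_swap pi q : q \in quarter n ->
  pedge (swap p * pi)%g q = pedge pi (swap_pos p q).
Proof.
move: hp; rewrite !inE /= => /andP[/andP[h1 h2] _] /andP[h3 h4].
rewrite /pedge /= !permM.
have t1 : tperm (rev_ord y) (rev_ord p.2) (tperm x p.1 q.1) = tperm x p.1 q.1.
  by apply: tpermD; rewrite eq_sym row_neq_col // tperm_ltn.
have t2 : tperm x p.1 (rev_ord q.2) = rev_ord q.2.
  by apply: tpermD; rewrite row_neq_col.
by rewrite t1 t2 (inj_tperm _ _ _ rev_ord_inj).
Qed.

Lemma imset_swap pi (S : {set 'I_n * 'I_n}) : S \subset quarter n ->
  (forall q, (swap_pos p q \in S) = (q \in S)) ->
  pedge (swap p * pi)%g @: S = pedge pi @: S.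
Proof.
move=> SK invS; apply/setP => e; apply/imsetP/imsetP => -[q qS ->].
  by exists (swap_pos p q); rewrite ?invS // pedge_swap // (subsetP SK).
exists (swap_pos p q); rewrite ?invS // pedge_swap ?swap_posK //.
by rewrite (subsetP SK) // invS.
Qed.

End Swap.
End Geometry.

(** * One round: symmetry and the chances of a right or a wrong hit *)

Section OneRound.
Variables (R : realType) (n : nat).
Implicit Types (Y M S : {set {set 'I_n}}) (e : {set 'I_n}).

(** [Y] is the random edge set, [S] the diagonal pairs, [M] the output, [e] the hidden pair. A right
    hit will force a correct answer from Bob, and a wrong answer will force a wrong hit. *)
Definition right_hit Y S M e : bool := (e \in M) && (M :&: S \subset Y).

Definition wrong_hit Y S M e : bool :=
  [&& e \in M, e \notin Y & (M :&: S) :\ e \subset Y].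

Lemma wrong_hit_uniq Y S M e e' : e \in S -> e' \in S ->
  wrong_hit Y S M e -> wrong_hit Y S M e' -> e = e'.
Proof.
move=> eS e'S /and3P[eM eY subY] /and3P[e'M e'Y _].
apply: contraNeq e'Y => ne; apply: (subsetP subY).
by rewrite in_setD1 in_setI e'M e'S eq_sym ne.
Qed.

(** The second component ranges over all families of vertex sets, so that complementing and masking
    are bijections; [inserted] retains only pairs of the quarter. *)
Definition hidden_coins : finType :=
  ({perm 'I_n} * {set {set 'I_n}})%type.

Definition hidden_coin0 : hidden_coins := (1%g, set0).

Definition hidden_dist : fdist R hidden_coins := unif R hidden_coin0.

Definition kept (x y : 'I_n) (pi : {perm 'I_n}) : {set {set 'I_n}} :=
  pedge pi @: unseen x y :|: pedge pi @: diagonal x y.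

Definition inserted (om : hidden_coins) : {set {set 'I_n}} :=
  om.2 :&: pedge om.1 @: quarter n.

Definition deleted (x y : 'I_n) (om : hidden_coins) : {set {set 'I_n}} :=
  inserted om :\: kept x y om.1.

Definition final (x y : 'I_n) (om : hidden_coins) : {set {set 'I_n}} :=
  inserted om :\: deleted x y om.

Variables (x y : 'I_n).
Hypotheses (hx : (x < n./2)%N) (hy : (y < n./2)%N).

Let diag (pi : {perm 'I_n}) := pedge pi @: diagonal x y.

Lemma finalE om : final x y om = om.2 :&: kept x y om.1.
Proof.
apply/setP => e; rewrite /final /deleted !in_setD negb_and negbK !in_setI.
case: (e \in om.2); rewrite ?andbF //=.
case: (boolP (e \in kept x y om.1)) => [eW|_] /=.
  rewrite (subsetP _ _ eW) // subUset !imsetS //.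
    exact: diagonal_quarter.
  exact: unseen_quarter.
by case: (e \in _).
Qed.

(** Multiplying [pi] by [swap p] preserves the uniform law and the four sets given to [Psi], but
    turns the hidden pair into that of [p]; hence all diagonal positions contribute equally. *)
Lemma symmetrize
    (Psi : {set {set 'I_n}} -> {set {set 'I_n}} -> {set {set 'I_n}} ->
           {set {set 'I_n}} -> {set 'I_n} -> R) :
  let psi (om : hidden_coins) :=
    Psi (inserted om) (deleted x y om) (diag om.1) om.2 in
  #|diagonal x y|%:R * Ex hidden_dist (fun om => psi om (pedge om.1 (x, y))) =
  Ex hidden_dist (fun om => \sum_(e in diag om.1) psi om e).
Proof.
move=> psi; transitivity (Ex hidden_dist (fun om =>
    \sum_(p in diagonal x y) psi om (pedge om.1 p))); last first.
  apply: eq_Ex => om; rewrite big_imset //= => p q hp hq.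
  by apply: pedge_inj; apply: (subsetP (diagonal_quarter x y)).
rewrite Ex_sum mulr_natl -sumr_const; apply: eq_bigr => p hp.
have phi_inj :
    injective (fun om : hidden_coins => ((swap x y p * om.1)%g, om.2)).
  by move=> [pi Y] [pi' Y'] [/mulgI -> ->].
rewrite /hidden_dist (Ex_unif_reindex _ _ phi_inj); apply: eq_Ex => -[pi Y] /=.
have cd := corner_diagonal hx hy.
rewrite /psi /deleted /inserted /kept /diag /=.
rewrite (imset_swap hx hy hp pi (subxx _) (swap_pos_quarter hx hy hp)).
rewrite (imset_swap hx hy hp pi (unseen_quarter x y) (swap_pos_unseen hx hy hp)).
rewrite (imset_swap hx hy hp pi (diagonal_quarter x y)
  (swap_pos_diagonal hx hy hp)).
rewrite (pedge_swap hx hy hp) ?(subsetP (diagonal_quarter x y)) //.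
by rewrite /swap_pos /= !tpermL -surjective_pairing.
Qed.

(** A set and its complement are equally likely and share out the diagonal. *)
Lemma Ex_card_diag :
  Ex hidden_dist (fun om => #|om.2 :&: diag om.1|%:R) = #|diagonal x y|%:R / 2.
Proof.
have compl_inj : injective (fun om : hidden_coins => (om.1, ~: om.2)).
  by move=> [pi Y] [pi' Y'] [-> /setC_inj ->].
set E := LHS; suff : E + E = #|diagonal x y|%:R by lra.
rewrite {2}/E /hidden_dist (Ex_unif_reindex _ _ compl_inj) -ExD.
rewrite -[RHS](Ex_cst hidden_dist); apply: eq_Ex => -[pi Y] /=.
rewrite -natrD [Y :&: _]setIC [~: Y :&: _]setIC -setDE cardsID.
rewrite card_in_imset // => p q hp hq.
by apply: pedge_inj; apply: (subsetP (diagonal_quarter x y)).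
Qed.

(** The vertices of the first [x] rows and the first [y] columns hit every unseen pair. *)
Lemma card_matching_unseen pi M :
  trivIset M -> M \subset pedge pi @: unseen x y -> (#|M| <= x + y)%N.
Proof.
move=> trivM MU.
pose Q := pi @: ([set i : 'I_n | (i < x)%N] :|:
                 @rev_ord n @: [set j : 'I_n | (j < y)%N]).
have cardlt (z : 'I_n) : #|[set i : 'I_n | (i < z)%N]| = z.
  have w_inj : injective (widen_ord (ltnW (ltn_ord z))).
    by move=> i j /(congr1 val) /= /val_inj.
  rewrite -[RHS]card_ord -(card_imset _ w_inj).
  apply: eq_card => i; rewrite inE; apply/idP/imsetP => [iz|[j _ ->]] /=.
    by exists (Ordinal iz) => //; apply/val_inj.
  exact: ltn_ord.
have cardQ : (#|Q| <= x + y)%N.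
  rewrite card_imset; last exact: perm_inj.
  apply: leq_trans (leq_card_setU _ _) _.
  by rewrite card_imset ?cardlt //; exact: rev_ord_inj.
apply: leq_trans cardQ; apply: card_matching_hitting => // e /(subsetP MU).
move=> /imsetP[[i j] hp ->]; apply/set0Pn; move: hp; rewrite !inE /=.
move=> /andP[_ /orP[lt|lt]].
  exists (pi i); rewrite in_setI mem_pedge eqxx (mem_imset _ _ perm_inj).
  by rewrite !inE lt.
exists (pi (rev_ord j)); rewrite in_setI mem_pedge eqxx orbT.
by rewrite (mem_imset _ _ perm_inj) inE (mem_imset _ _ rev_ord_inj) !inE lt orbT.
Qed.

Lemma inserted_card2 om : {in inserted om, forall e, #|e| = 2%N}.
Proof.
by move=> e; rewrite in_setI => /andP[_ /imsetP[p hp ->]]; apply: card_pedge.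
Qed.

Variable (C : R).
Hypothesis C_gt0 : 0 < C.

Definition correct (G M : {set {set 'I_n}}) : bool :=
  is_matching G M && ((matching_number G)%:R / C <= #|M|%:R).

(** A correct output has no non-edge and at most [x + y] edges off the diagonal, while the surviving
    diagonal edges bound the matching number from below. For an incorrect output the last term makes
    the left side nonpositive. *)
Lemma right_hit_count om M (G := final x y om) :
  #|om.2 :&: diag om.1|%:R / C - (x + y)%:R
    - #|diagonal x y|%:R / C * (~~ correct G M)%:R
  <= \sum_(e in diag om.1) (right_hit om.2 (diag om.1) M e)%:R :> R.
Proof.
set D := diag om.1.
have cardD : (#|om.2 :&: D| <= #|diagonal x y|)%N.
  by apply: leq_trans (leq_imset_card (pedge om.1) _); apply/subset_leq_card/subsetIr.
case: (boolP (correct G M)) => [/andP[/andP[MG trivM] apxM]|_] /=; last first.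
  apply: le_trans (_ : 0 <= _); last exact: sumr_ge0.
  rewrite mulr1 addrAC -mulrBl subr_le0; apply: le_trans (_ : 0 <= _) => //.
  by rewrite pmulr_lle0 ?invr_gt0 // subr_le0 ler_nat.
rewrite mulr0 subr0.
have GE : G = om.2 :&: kept x y om.1 by exact: finalE.
have MY : M \subset om.2 by rewrite (subset_trans MG) // GE subsetIl.
have -> : \sum_(e in D) (right_hit om.2 D M e)%:R = #|M :&: D|%:R :> R.
  rewrite -sum1_card natr_sum big_mkcond [RHS]big_mkcond /=.
  apply: eq_bigr => e _; rewrite in_setI /right_hit.
  rewrite (subset_trans (subsetIl _ _) MY) andbT andbC.
  by case: (e \in D); case: (e \in M).
have Msplit : (#|M| <= #|M :&: D| + (x + y))%N.
  rewrite -(cardsID D M) leq_add2l; apply: (@card_matching_unseen om.1).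
    exact: trivIsetS (subsetDl _ _) trivM.
  apply/subsetP => e /setDP[/(subsetP MG)]; rewrite GE in_setI in_setU.
  by case/andP=> _ /orP[//|->].
have mu : (#|om.2 :&: D| <= matching_number G)%N.
  apply: (@leq_bigmax_cond _ (is_matching G) (fun M => #|M|)).
  by rewrite /is_matching diagonal_matching // andbT GE setIS // subsetUr.
rewrite lerBlDr -natrD; apply: le_trans (_ : #|M|%:R <= _); last by rewrite ler_nat.
by apply: le_trans apxM; rewrite ler_wpM2r ?invr_ge0 ?ler_nat // ltW.
Qed.

(** A correct output contains no non-edge; an incorrect one has at most one wrong hit, by
    uniqueness. *)
Lemma wrong_hit_count om M (G := final x y om) :
  \sum_(e in diag om.1) (wrong_hit om.2 (diag om.1) M e)%:R
  <= (~~ correct G M)%:R :> R.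
Proof.
set D := diag om.1.
case: (boolP (correct G M)) => [/andP[/andP[MG _] _]|_] /=.
  rewrite big1 // => e _; rewrite /wrong_hit; case eM: (e \in M) => //=.
  by move/(subsetP MG): eM; rewrite [G]finalE in_setI => /andP[-> _].
case: (pickP [pred e in D | wrong_hit om.2 D M e]) => [e /andP[/= eD we]|none].
  rewrite (bigD1 e) //= we big1 ?addr0 // => e' /andP[e'D ne].
  case we': (wrong_hit _ _ _ e') => //.
  by rewrite (wrong_hit_uniq e'D eD we' we) eqxx in ne.
rewrite big1 // => e eD; have := none e; rewrite /= eD /= => -> //.
Qed.

Variables (s : nat) (A : stream_alg R 'I_n s).
Hypothesis solA : bipartite_matching_alg A C (1 / 10).

Definition alg_dist (om : hidden_coins) : fdist R {set {set 'I_n}} :=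
  alg_output A (insertions (inserted om) ++ deletions (deleted x y om)).

Lemma alg_dist_incorrect om :
  Ex (alg_dist om) (fun M => (~~ correct (final x y om) M)%:R) <= 1 / 10.
Proof.
have [valid fin] := insert_delete (@inserted_card2 om)
  (subsetDl (inserted om) (kept x y om.1)).
rewrite -/(deleted x y om) in valid fin.
have bip : bipartite (final x y om).
  apply: (@bipartite_pedge n om.1).
  by apply: subset_trans (subsetDl _ _) _; apply: subsetIr.
have : 1 - 1 / 10 <= Pr (alg_dist om) (correct (final x y om)).
  by have := solA valid; rewrite fin; apply.
have := PrC (alg_dist om) (correct (final x y om)); rewrite PrE /= => ->.
lra.
Qed.

(** The factor [2 / 5] is [1 / 2 - 1 / 10]: half of the diagonal is present on average, and errors
    of the algorithm cost at most a tenth of it. *)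
Lemma right_hit_prob :
  #|diagonal x y|%:R * (2 / 5) / C - (x + y)%:R <=
  #|diagonal x y|%:R * Ex hidden_dist (fun om => Ex (alg_dist om) (fun M =>
    (right_hit om.2 (diag om.1) M (pedge om.1 (x, y)))%:R)).
Proof.
pose Psi E F D Y e : R := Ex (alg_output A (insertions E ++ deletions F))
  (fun M => (right_hit Y D M e)%:R).
rewrite (symmetrize Psi) /Psi.
pose low (om : hidden_coins) : R := C^-1 * #|om.2 :&: diag om.1|%:R
  + - ((x + y)%:R + #|diagonal x y|%:R / C * (1 / 10)).
apply: le_trans (_ : Ex hidden_dist low <= _).
  by rewrite ExD ExZ Ex_card_diag Ex_cst; lra.
apply: le_Ex => om; rewrite -(Ex_sum (alg_dist om)).
pose a : R := #|om.2 :&: diag om.1|%:R / C - (x + y)%:R.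
pose c : R := #|diagonal x y|%:R / C.
apply: le_trans (_ : Ex (alg_dist om) (fun M =>
    a + (- c) * (~~ correct (final x y om) M)%:R) <= _); last first.
  by apply: le_Ex => M; rewrite mulNr; apply: right_hit_count.
rewrite ExD ExZ Ex_cst /low [C^-1 * _]mulrC opprD addrA lerD2l mulNr lerN2.
apply: ler_wpM2l; last exact: alg_dist_incorrect.
by rewrite divr_ge0 // ltW.
Qed.

Lemma wrong_hit_prob :
  #|diagonal x y|%:R * Ex hidden_dist (fun om => Ex (alg_dist om) (fun M =>
    (wrong_hit om.2 (diag om.1) M (pedge om.1 (x, y)))%:R)) <= 1 / 10.
Proof.
pose Psi E F D Y e : R := Ex (alg_output A (insertions E ++ deletions F))
  (fun M => (wrong_hit Y D M e)%:R).
rewrite (symmetrize Psi) /Psi -[leRHS](Ex_cst hidden_dist).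
apply: le_Ex => om; rewrite -(Ex_sum (alg_dist om)).
apply: le_trans (alg_dist_incorrect om).
by apply: le_Ex => M; apply: wrong_hit_count.
Qed.

End OneRound.

(** * The protocol *)

Section Protocol.
Variables (R : realType) (n s : nat).
Implicit Types (A : 'M[bool]_n) (B : 'M[option bool]_n) (om : hidden_coins n).

Definition masked A om : {set {set 'I_n}} :=
  [set e : {set 'I_n} | (e \in om.2) (+)
     (e \in pedge om.1 @: [set q in quarter n | A q.1 q.2])].

Definition mask A om : hidden_coins n := (om.1, masked A om).

(** Masking twice is the identity. As with a one-time pad, the masked set is therefore uniform
    whatever the matrix. *)
Lemma mask_inj A : injective (mask A).
Proof.
apply: (can_inj (g := mask A)) => -[pi X]; congr (_, _).
by apply/setP => e; rewrite !inE addbK.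
Qed.

Lemma masked_pedge A om (q : 'I_n * 'I_n) : q \in quarter n ->
  (pedge om.1 q \in masked A om) = (pedge om.1 q \in om.2) (+) A q.1 q.2.
Proof.
move=> hq; rewrite in_set; congr (_ (+) _); apply/imsetP/idP => [[q' hq'] e|Aq].
  move: hq'; rewrite in_set => /andP[hq' Aq'].
  by rewrite (pedge_inj hq hq' e).
by exists q => //; rewrite in_set hq.
Qed.

(* Junk entries [false] replace those Bob does not know. *)
Definition guessed B : 'M[bool]_n := \matrix_(i, j) odflt false (B i j).

(** Bob bets that the reported pair [e0] is an edge; by the xor in [masked], the entry is then the
    negation of its membership in [om.2]. *)
Definition answer (x y : 'I_n) B om (M : {set {set 'I_n}}) : option bool :=
  let e0 := pedge om.1 (x, y) in
  if (e0 \in M) && ((M :&: pedge om.1 @: diagonal x y) :\ e0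
                      \subset masked (guessed B) om)
  then Some (e0 \notin om.2) else None.

Section Agreement.
Variables (k : R) (A : 'M[bool]_n) (x y : 'I_n).
Hypotheses (hx : (x < n./2)%N) (hy : (y < n./2)%N) (hk : (n./2)%:R <= k).
Let B := BInd_view k A x y.

(** By [hk] the window reaches the far end of the quarter wherever it starts. *)
Lemma masked_guessed om (q : 'I_n * 'I_n) :
  q \in quarter n -> q \notin unseen x y -> q != (x, y) ->
  (pedge om.1 q \in masked (guessed B) om) = (pedge om.1 q \in masked A om).
Proof.
move=> hq nq qxy; rewrite !masked_pedge // mxE mxE; congr (_ (+) _).
move: nq; rewrite in_set hq /= negb_or -!leqNgt => /andP[xq yq].
move: hq; rewrite in_set => /andP[hq1 hq2].
have lt_window (z i : 'I_n) : (i < n./2)%N -> (i%:R : R) < z%:R + k.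
  move=> hi; apply: lt_le_trans (_ : (n./2)%:R <= _); first by rewrite ltr_nat.
  by rewrite (le_trans hk) // lerDr.
by rewrite /BInd_known /BInd_window xq yq !lt_window //= -surjective_pairing qxy.
Qed.

(** Within the quarter, every pair whose entry Bob may guess wrongly is in [kept], so he can compute
    the deletions. *)
Lemma deleted_guessed om :
  deleted x y (mask (guessed B) om) = deleted x y (mask A om).
Proof.
apply/setP => e; rewrite !in_setD /=; case: (boolP (e \in kept _ _ _)) => //= nk.
rewrite !in_setI /=; case: (boolP (e \in _ @: quarter n)); rewrite ?andbF //.
case/imsetP=> q hq eE; rewrite !andbT eE masked_guessed //.
  by apply: contra nk => qU; rewrite eE in_setU imset_f.
apply: contra nk => /eqP qxy.
by rewrite eE qxy in_setU orbC imset_f // corner_diagonal.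
Qed.

Lemma diagonal_agree om (M : {set {set 'I_n}}) :
  ((M :&: pedge om.1 @: diagonal x y) :\ pedge om.1 (x, y)
     \subset masked (guessed B) om) =
  ((M :&: pedge om.1 @: diagonal x y) :\ pedge om.1 (x, y)
     \subset masked A om).
Proof.
have agree : {in (M :&: pedge om.1 @: diagonal x y) :\ pedge om.1 (x, y),
    masked (guessed B) om =i masked A om}.
  move=> e; rewrite in_setD1 in_setI => /andP[ne /andP[_ /imsetP[q hq eE]]].
  rewrite eE masked_guessed //.
  - exact: (subsetP (diagonal_quarter x y)).
  - move: hq; rewrite !in_set => /andP[_ /and3P[xq yq _]].
    by rewrite negb_and negb_or -!leqNgt xq yq andbT orbT.
  - by apply: contraNneq ne => qxy; rewrite eE qxy.
by apply/subsetP/subsetP => sub e he; [rewrite -agree | rewrite agree];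
  rewrite ?sub.
Qed.

Lemma right_hit_answer om (M : {set {set 'I_n}}) :
  right_hit (masked A om) (pedge om.1 @: diagonal x y) M (pedge om.1 (x, y)) ->
  answer x y B om M == Some (A x y).
Proof.
have cd := corner_diagonal hx hy.
move=> /andP[eM sub]; rewrite /answer eM diagonal_agree.
rewrite (subset_trans (subsetDl _ _) sub) /=.
have /(subsetP sub) : pedge om.1 (x, y) \in M :&: pedge om.1 @: diagonal x y.
  by rewrite in_setI eM imset_f.
rewrite masked_pedge ?(subsetP (diagonal_quarter x y)) //=.
by case: (_ \in om.2); case: (A x y).
Qed.

Lemma answer_wrong_hit om (M : {set {set 'I_n}}) :
  answer x y B om M == Some (~~ A x y) ->
  wrong_hit (masked A om) (pedge om.1 @: diagonal x y) M (pedge om.1 (x, y)).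
Proof.
have cd := corner_diagonal hx hy.
rewrite /answer diagonal_agree; case: ifP => // /andP[eM sub].
rewrite /wrong_hit eM sub andbT masked_pedge ?(subsetP (diagonal_quarter x y)) //=.
by case: (_ \in om.2); case: (A x y).
Qed.

End Agreement.

Variables (S : stream_alg R 'I_n s) (C : R).
Hypotheses (C_gt0 : 0 < C) (solS : bipartite_matching_alg S C (1 / 10)).

Definition round_coin : finType := sim_coin S (hidden_coins n).

Definition round_dist : fdist R round_coin := sim_dist S (hidden_coin0 n).

Definition round_alice (c : round_coin) A : s.-tuple bool :=
  sim_mem c (inserted (mask A (sim_om c))).

Definition round_bob (c : round_coin) (m : s.-tuple bool) (x y : 'I_n) B :
    option bool :=
  answer x y B (sim_om c)
    (sim_out c (deleted x y (mask (guessed B) (sim_om c))) m).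

Section Bounds.
Variables (k : R) (A : 'M[bool]_n) (x y : 'I_n).
Hypotheses (hx : (x < n./2)%N) (hy : (y < n./2)%N) (hk : (n./2)%:R <= k).

(** The change of variables [mask A] leads to an experiment independent of [A]. *)
Lemma Ex_round (f : hidden_coins n -> {set {set 'I_n}} -> R) :
  Ex round_dist (fun c => f (mask A (sim_om c))
    (sim_out c (deleted x y (mask A (sim_om c))) (round_alice c A))) =
  Ex (hidden_dist R n) (fun om => Ex (alg_dist x y S om) (f om)).
Proof.
rewrite /round_alice (Ex_sim S (hidden_coin0 n)
  (@inserted n \o mask A) (@deleted n x y \o mask A) (fun om => f (mask A om))).
by rewrite [RHS](Ex_unif_reindex _ _ (@mask_inj A)).
Qed.

Lemma round_right :
  #|diagonal x y|%:R * (2 / 5) / C - (x + y)%:R <=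
  #|diagonal x y|%:R * Pr round_dist (fun c =>
    round_bob c (round_alice c A) x y (BInd_view k A x y) == Some (A x y)).
Proof.
apply: le_trans (right_hit_prob hx hy C_gt0 solS) _.
rewrite ler_wpM2l // PrE -Ex_round; apply: le_Ex => c.
rewrite /round_bob deleted_guessed //; set M := sim_out _ _ _.
case: (boolP (right_hit _ _ _ _)) => // hit.
by rewrite (right_hit_answer hx hy hk hit).
Qed.

Lemma round_wrong :
  #|diagonal x y|%:R * Pr round_dist (fun c =>
    round_bob c (round_alice c A) x y (BInd_view k A x y) == Some (~~ A x y))
  <= 1 / 10.
Proof.
apply: le_trans (wrong_hit_prob hx hy solS).
rewrite ler_wpM2l // PrE -Ex_round; apply: le_Ex => c.
rewrite /round_bob deleted_guessed //; set M := sim_out _ _ _.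
case: (boolP (_ == _)) => // wrong.
by rewrite (answer_wrong_hit hx hy hk wrong).
Qed.

End Bounds.
End Protocol.

(** The inductive step is [(1 - p) * (1 + (t + 1) * p) <= 1 + t * p]. *)
Lemma bernoulli_inv (R : realFieldType) (p : R) (t : nat) :
  0 <= p -> p <= 1 -> (1 - p) ^+ t * (1 + t%:R * p) <= 1.
Proof.
move=> p0 p1; elim: t => [|t IH]; first by rewrite expr0 mul0r addr0 mul1r.
apply: le_trans IH; rewrite exprSr -mulrA ler_wpM2l ?exprn_ge0 ?subr_ge0 //.
rewrite -natr1; have : (0 : R) <= t%:R by [].
nra.
Qed.

Theorem theorem5 (R : realType) (eps : R) (eps_gt0 : 0 < eps) (eps_lt1 : eps < 1) :
  exists2 K : R, 0 < K &
  forall (n s : nat) (A : stream_alg R 'I_n s),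
    bipartite_matching_alg A (n%:R `^ eps) (1 / 10) ->
    exists (b : nat) (P : protocol R n b),
      b%:R <= K * (n%:R `^ eps * s%:R) /\
      solves_BInd (n%:R - 1 / 40 * n%:R `^ (1 - eps)) (1 / 20) P.
Proof.
(* There will be at most [200 * C] rounds of [s] bits each. *)
exists 200 => // n s A solA; case: (posnP n) => [n0|n_pos].
  exists 0%N, (@Protocol R n 0 unit (dirac R tt)
    (fun _ _ => [tuple]) (fun _ _ _ _ _ => false)); split.
    by rewrite !mulr_ge0 ?powR_ge0.
  by move=> M x; have := ltn_ord x; rewrite [X in (_ < X)%N]n0.
set C := n%:R `^ eps in solA *.
set m := n%:R `^ (1 - eps); set k := n%:R - _.
have n_ge1 : 1 <= n%:R :> R by rewrite ler1n.
have n_gt0 : 0 < n%:R :> R by rewrite ltr0n.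
have Cm : C * m = n%:R.
  rewrite /C /m -powRD; last by rewrite [n%:R == 0]gt_eqF ?implybT.
  by rewrite addrC subrK powRr1 // ltW.
have C_ge1 : 1 <= C.
  by rewrite -(powRr0 n%:R) ler_powR // ltW.
have C_gt0 : 0 < C by lra.
(* A legal position has [x + 1 <= m / 40]; multiplying by [C] and using [C * m = n] yields the
   bounds. Even [40 * C <= n] rests on such a position existing; without one there is nothing to
   solve. *)
have geom (x y : 'I_n) : BInd_range k x -> BInd_range k y ->
  [/\ 40 * C <= n%:R, (x < n./2)%N, (y < n./2)%N, (n./2)%:R <= k
    & 20 * C * (x + y)%:R <= n%:R /\ 9 * n%:R <= 20 * #|diagonal x y|%:R :> R].
  move=> rx ry.
  rewrite /BInd_range /k opprB addrC subrK -addn1 natrD in rx ry.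
  have x0 : 0 <= x%:R :> R by [].
  have y0 : 0 <= y%:R :> R by [].
  have hCx : 40 * C * (x%:R + 1) <= n%:R by nra.
  have hCy : 40 * C * (y%:R + 1) <= n%:R by nra.
  have hx40 : (40 * (x + 1) <= n)%N.
    by rewrite -(ler_nat R) natrM natrD; nra.
  have hy40 : (40 * (y + 1) <= n)%N.
    by rewrite -(ler_nat R) natrM natrD; nra.
  have hx : (x < n./2)%N by clear -hx40; lia.
  have hy : (y < n./2)%N by clear -hy40; lia.
  split=> //; first by nra.
    have half_n : (n./2)%:R * 2 <= n%:R :> R by rewrite -natrM ler_nat; clear; lia.
    have m_le : m <= n%:R by nra.
    by rewrite /k; lra.
  split; first by rewrite natrD; nra.
  rewrite -!natrM ler_nat.
  by have := card_diagonal hx hy; clear -hx40 hy40; lia.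
pose t := Num.truncn (200 * C).
have [t_le t_gt] : t%:R <= 200 * C /\ 200 * C < t.+1%:R.
  by apply/andP; apply: truncn_itv; lra.
(* With [d] the diagonal length, [C * (x + y) <= n / 20 <= d / 9] and [2 / 5 - 1 / 9 > 1 / 4]
   justify [p0]; [q] is [1 / 10] divided by the lower bound [9 * n / 20] on [d]. *)
pose p0 := (4 * C)^-1; pose q : R := 2 / (9 * n%:R).
have p0C : p0 * C = 1 / 4 by rewrite /p0; field; lra.
have p0_gt0 : 0 < p0 by rewrite invr_gt0; lra.
have qn : q * n%:R = 2 / 9 by rewrite /q; field; lra.
have q_ge0 : 0 <= q by rewrite divr_ge0 //; lra.
have [||P solP] := @amplify R n s _ (round_dist A) (@round_alice _ _ _ A)
  (@round_bob _ _ _ A) k p0 q t p0_gt0 q_ge0.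
- move=> M x y rx ry; have [_ hx hy hk [Cxy nd]] := geom x y rx ry.
  have := round_right C_gt0 solA M hx hy hk.
  set p := Pr _ _; set d := #|_|%:R in nd *; set xy := (x + y)%:R in Cxy *.
  rewrite -(ler_pM2r C_gt0) mulrBl divfK ?gt_eqF // => h.
  have d_gt0 : 0 < d by lra.
  rewrite -(ler_pM2r C_gt0) p0C -(ler_pM2l d_gt0); lra.
- move=> M x y rx ry; have [_ hx hy hk [Cxy nd]] := geom x y rx ry.
  have := round_wrong solA M hx hy hk.
  set p := Pr _ _; set d := #|_|%:R in nd *; have p_ge0 : 0 <= p.
    by rewrite /p /Pr sumr_ge0 // => i _; apply: pmf_ge0.
  by move=> dp_le; rewrite -(ler_pM2r n_gt0) qn; nra.
exists (t * s)%N, P; split; first by rewrite natrM mulrA ler_wpM2r.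
move=> M x y rx ry; apply: le_trans (solP M x y rx ry).
have [Cn _ _ _ _] := geom x y rx ry.
rewrite lerD2l lerN2.
have p0_le1 : p0 <= 1 by nra.
have := bernoulli_inv t (ltW p0_gt0) p0_le1; set E := _ ^+ t.
have E_ge0 : 0 <= E by rewrite exprn_ge0 // subr_ge0.
(* The error budget: [E <= 1 / 50] from Bernoulli and [q / p0 <= 1 / 45] from [40 * C <= n],
   together below [1 / 20]. *)
have tp : 49 <= t%:R * p0 by move: t_gt; rewrite -natr1; nra.
have : q / p0 <= 1 / 45 by rewrite ler_pdivrMr //; nra.
nra.
Qed.
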